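(* For every integer $n\ge 1$ there exists $P_0=P_0(n)>1$ such that for every rational number $P\ge P_0$ and every $L\in\{0,1,\dots,\lceil n/2\rceil-1\}$ the following holds. Put $b:=L+1/P$ (so $\lceil b\rceil=L+1$) and $$\mathcal{F}_{01}:=\Big\{x\in\mathbb{R}^n:\ x_i^2-x_i=0\ \ \forall i\in\{1,\dots,n\},\ \ \sum_{i=1}^n x_i\ge b\Big\}.$$ If $d\ge 0$ is an integer such that every feasible solution $y$ of the $d$-SoS relaxation of $\mathcal{F}_{01}$ satisfies $\sum_{i=1}^n y[x_i]\ge\lceil b\rceil$, then $d\ge n-L$. In other words, the $d$-SoS$(\mathcal{F}_{01})$ relaxation requires $d\ge n-L$ for enforcing $\sum_{i=1}^n x_i\ge\lceil b\rceil$.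
   Context: For $p\in\mathbb{R}[x]=\mathbb{R}[x_1,\dots,x_n]$, let $\overline{p}$ denote its multilinear form, obtained by replacing every occurrence of $x_i^k$ with $k\ge2$ by $x_i$. Put $x_0:=1$. Let $\mathcal{S}$ be a finite set of multilinear polynomials with span $\langle\mathcal{S}\rangle$, and let $T:=\{\overline{x_i\,p\,q}: p,q\in\mathcal{S},\ i\in\{0,1,\dots,n\}\}$. For a set $\{x\in\mathbb{R}^n: x_i^2-x_i=0\ \forall i,\ g_1(x)\ge0,\dots,g_m(x)\ge0\}$ with linear (affine) $g_j$, the feasible solutions of the $\mathcal{S}$-SoS relaxation are the linear functionals $y:\langle T\rangle\to\mathbb{R}$, $p\mapsto y[p]$, such that - $y[1]=1$, - $y[\overline{q^2}]\ge0$ for all $q\in\langle\mathcal{S}\rangle$, - $y[\overline{q^2 g_j}]\ge0$ for all $q\in\langle\mathcal{S}\rangle$ and all $j\in\{1,\dots,m\}$. The $d$-SoS relaxation (standard Lasserre hierarchy) is the $\mathcal{S}$-SoS relaxation in which $\mathcal{S}$ is the set of all multilinear monomials of degree at most $d$. For $\mathcal{F}_{01}$ in the claim there is a single constraint ($m=1$), namely $g_1(x)=\sum_{i=1}^n x_i-b$. *)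

(* Defs.v *)
From HB Require Import structures.
From mathcomp Require Import all_boot all_order all_algebra.
From mathcomp Require Import reals.
From mathcomp Require Import mpoly.
Set Implicit Arguments.
Unset Strict Implicit.
Unset Printing Implicit Defensive.
Import Order.TTheory GRing.Theory Num.Theory.
Local Open Scope ring_scope.

Definition multilinear_mon (n : nat) (m : 'X_{1..n}) : 'X_{1..n} :=
  [multinom minn (m i) 1 | i < n].

Definition mlin (n : nat) (R : realType) (p : {mpoly R[n]}) : {mpoly R[n]} :=
  \sum_(m <- msupp p) p@_m *: 'X_[multilinear_mon m].

Definition in_span (n : nat) (R : realType) (S : seq {mpoly R[n]})
    (p : {mpoly R[n]}) : Prop :=
  exists c : {mpoly R[n]} -> R, p = \sum_(s <- S) c s *: s.

(* The first factor ranges over x_0 = 1, x_1, ..., x_n. *)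
Definition sos_moments (n : nat) (R : realType) (S : seq {mpoly R[n]}) :
    seq {mpoly R[n]} :=
  [seq mlin (x * pq) | x <- 1 :: [seq 'X_i | i : 'I_n],
                       pq <- [seq p * q | p <- S, q <- S]].

(* A linear functional on the span of [sos_moments S] is represented by a
   function on all polynomials that is linear on that span; its values outside
   the span are irrelevant.  The list [gs] holds the affine polynomials of the
   constraints g >= 0; for such g the products q ^+ 2 * g reduce into the span,
   and 1 is in it as soon as 1 is in S. *)
Definition sos_feasible (n : nat) (R : realType) (S gs : seq {mpoly R[n]})
    (y : {mpoly R[n]} -> R) : Prop :=
  [/\ forall (a : R) (p q : {mpoly R[n]}),
        in_span (sos_moments S) p -> in_span (sos_moments S) q ->
        y (a *: p + q) = a * y p + y q,
      y 1 = 1,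
      forall q : {mpoly R[n]}, in_span S q -> 0 <= y (mlin (q ^+ 2))
    & forall q g : {mpoly R[n]}, in_span S q -> g \in gs ->
        0 <= y (mlin (q ^+ 2 * g))].

Definition multilinear_monomials (n : nat) (R : realType) (d : nat) :
    seq {mpoly R[n]} :=
  [seq \prod_(i in A) 'X_i |
    A : {set 'I_n} in [pred A : {set 'I_n} | (#|A| <= d)%N]].

Definition lasserre_feasible (n : nat) (R : realType) (d : nat)
    (gs : seq {mpoly R[n]}) (y : {mpoly R[n]} -> R) : Prop :=
  sos_feasible (multilinear_monomials n R d) gs y.

(* The 0/1 set with x_1 + ... + x_n >= b enters its relaxations only through
   its linear constraints; x_i^2 = x_i is built into [mlin]. *)
Definition F01_constraints (n : nat) (R : realType) (b : R) :
    seq {mpoly R[n]} :=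
  [:: \sum_(i < n) 'X_i - b%:MP].

(* Main.v *)
Require Import Defs.
From HB Require Import structures.
From mathcomp Require Import all_boot all_order all_algebra.
From mathcomp Require Import reals.
From mathcomp Require Import mpoly.
From mathcomp Require Import ring lra.
Set Implicit Arguments.
Unset Strict Implicit.
Unset Printing Implicit Defensive.
Import Order.TTheory GRing.Theory Num.Theory.
Local Open Scope ring_scope.

(** Fix a set [S] of [L] coordinates and suppose that [d < n - L].  On the
    subcube of the vertices [A] containing [S], which has dimension [n - L], a
    polynomial [q] of degree at most [d] is orthogonal to the parity character
    ([subcube_parity_sum]).  Hence [q S] is a signed sum of the values [q A] over
    the at most [2 ^ n] vertices [A] strictly above [S], and by Cauchy-Schwarz
    [q S ^+ 2] is at most [2 ^ n] times the sum of their squares: no square of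
    a polynomial of degree at most [d] sees [S] without seeing the vertices
    above it ([sqr_bottom_le]).

    Take therefore the genuine probability measure with a small weight [eps] on
    each vertex strictly above [S] and the remaining mass on [S], and let [y] be
    its expectation.  Squares have nonnegative expectation.  The constraint
    [sum x_i - b] is violated only at [S], and there only by [1 / P], whereas at
    the other vertices it is at least [1 - 1 / P]; once [P - 1] is at
    least [2 ^ n / eps], the contribution of [S] to the expectation of
    [q ^+ 2 * (sum x_i - b)] is dominated by that of the vertices above.  So [y]
    is feasible ([expectation_near_feasible]), while [sum y x_i] is [L] plus at most
    [eps * 2 ^ n * n], which is below [L + 1] for small [eps]. *)

(** * Sums over subcubes *)

Lemma sqr_sum_le (R : realFieldType) (I : finType) (P : pred I) (F : I -> R) :
  (\sum_(i | P i) F i) ^+ 2 <= #|P|%:R * \sum_(i | P i) F i ^+ 2.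
Proof.
set Q := \sum_(i | P i) F i ^+ 2.
have sum_const (c : R) : \sum_(i | P i) c = #|P|%:R * c.
  by rewrite sumr_const mulr_natl.
have -> : (\sum_(i | P i) F i) ^+ 2 =
          \sum_(i | P i) \sum_(j | P j) F i * F j.
  by rewrite expr2 mulr_suml; apply: eq_bigr => i _; rewrite mulr_sumr.
have -> : #|P|%:R * Q =
          \sum_(i | P i) \sum_(j | P j) (F i ^+ 2 + F j ^+ 2) / 2.
  under eq_bigr => i _ do rewrite -mulr_suml big_split /= sum_const.
  rewrite -mulr_suml big_split /= sum_const -mulr_sumr -/Q; lra.
apply: ler_sum => i _; apply: ler_sum => j _.
have := sqr_ge0 (F i - F j); nra.
Qed.

(** Toggling a coordinate outside [C] pairs off the supersets of [C] with
    opposite signs. *)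
Lemma superset_sign_sum (R : pzRingType) (T : finType) (C : {set T}) :
  (#|C| < #|T|)%N -> \sum_(A : {set T} | C \subset A) (-1) ^+ #|A| = 0 :> R.
Proof.
rewrite -cardsT => ltCT; have [x _ xC] : exists2 x, x \in [set: T] & x \notin C.
  by apply/subsetPn/negP => /subset_leq_card; rewrite leqNgt ltCT.
rewrite (bigID (fun A : {set T} => x \in A)) /=.
rewrite (reindex_onto (fun A => x |: A) (fun A => A :\ x)) /=; last first.
  by move=> A /andP[_ xA]; rewrite setD1K.
rewrite (eq_bigl (fun A : {set T} => (C \subset A) && (x \notin A))); last first.
  move=> A; rewrite setU11 andbT; have [xA|xA] := boolP (x \in A).
    rewrite andbF; apply/andP => -[_ /eqP eA]; move: xA.
    by rewrite -eA !inE eqxx.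
  rewrite setU1K // eqxx !andbT.
  apply/idP/idP => [sCA|/subset_trans->//]; last exact: subsetUr.
  apply/subsetP => z zC; move/subsetP/(_ z zC): sCA; rewrite !inE.
  by case/orP => // /eqP zx; rewrite -zx zC in xC.
rewrite -big_split big1 //= => A /andP[_ xA].
by rewrite cardsU1 xA exprS mulN1r addNr.
Qed.

(** * Evaluation at the vertices of the 0/1 cube *)

Definition vertex (R : realType) (n : nat) (A : {set 'I_n}) : 'I_n -> R :=
  fun i => (i \in A)%:R.

Section Vertices.
Variables (R : realType) (n : nat).
Implicit Types (A B S : {set 'I_n}) (p q : {mpoly R[n]}).

Lemma meval_mlin A p : (mlin p).@[vertex R A] = p.@[vertex R A].
Proof.
rewrite /mlin raddf_sum mevalE; apply: eq_bigr => m _ /=.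
rewrite mevalZ mevalX; congr (_ * _); apply: eq_bigr => i _.
rewrite mnmE /vertex; case: (m i) => [|k]; first by rewrite min0n.
by rewrite minnSS minn0; case: (i \in A); rewrite ?expr1n ?expr0n.
Qed.

Lemma meval_vertex_prod A B :
  (\prod_(i in B) 'X_i : {mpoly R[n]}).@[vertex R A] = (B \subset A)%:R.
Proof.
rewrite rmorph_prod /=; under eq_bigr do rewrite mevalXU.
have [/subsetP sBA|/subsetPn[i iB iA]] := boolP (B \subset A).
  by rewrite big1 // => i /sBA iA; rewrite /vertex iA.
by rewrite (bigD1 i) //= /vertex (negPf iA) mul0r.
Qed.

Lemma meval_vertex_sum A :
  (\sum_(i < n) 'X_i : {mpoly R[n]}).@[vertex R A] = #|A|%:R.
Proof.
rewrite raddf_sum /= -sum1_card [in RHS]big_mkcond natr_sum; apply: eq_bigr => i _.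
by rewrite mevalXU /vertex; case: (i \in A).
Qed.

(** A monomial over [B] restricts the parity sum to the supersets of [S :|: B],
    and that set is still proper because [#|B| <= d]. *)
Lemma subcube_parity_sum d S q :
  (#|S| + d < n)%N -> in_span (multilinear_monomials n R d) q ->
  \sum_(A : {set 'I_n} | S \subset A) (-1) ^+ #|A| * q.@[vertex R A] = 0.
Proof.
move=> ltSd [c ->].
under eq_bigr do rewrite raddf_sum /= mulr_sumr.
rewrite exchange_big big_seq big1 //= => s /imageP[B leBd ->].
under eq_bigr do rewrite mevalZ meval_vertex_prod mulrCA.
rewrite -mulr_sumr.
have -> : \sum_(A : {set 'I_n} | S \subset A)
            (-1) ^+ #|A| * (B \subset A)%:R =
          \sum_(A : {set 'I_n} | S :|: B \subset A) (-1) ^+ #|A| :> R.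
  under [RHS]eq_bigl do rewrite subUset.
  by rewrite big_mkcondr; apply: eq_bigr => A _; rewrite mulr_natr mulrb.
rewrite superset_sign_sum ?mulr0 // card_ord.
apply: leq_ltn_trans ltSd; apply: leq_trans (leq_card_setU _ _) _.
by rewrite leq_add2l.
Qed.

Lemma sqr_bottom_le d S q :
  (#|S| + d < n)%N -> in_span (multilinear_monomials n R d) q ->
  q.@[vertex R S] ^+ 2 <=
    #|[pred A : {set 'I_n} | S \proper A]|%:R * \sum_(A : {set 'I_n} | S \proper A) q.@[vertex R A] ^+ 2.
Proof.
move=> ltSd /(subcube_parity_sum ltSd).
rewrite (bigD1 S) //= (eq_bigl (fun A => S \proper A)); last first.
  by move=> A; rewrite properEneq eq_sym andbC.
move/eqP; rewrite addr_eq0 => /eqP eqS.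
have -> : q.@[vertex R S] ^+ 2 =
    (\sum_(A : {set 'I_n} | S \proper A) (-1) ^+ #|A| * q.@[vertex R A]) ^+ 2.
  by rewrite -[RHS]sqrrN -eqS exprMn sqrr_sign mul1r.
under [X in _ <= _ * X]eq_bigr => A _.
  rewrite -[_ ^+ 2]mul1r -(sqrr_sign R #|A|) -exprMn.
  over.
exact: sqr_sum_le.
Qed.

(** * The feasible functional *)

(** Expectation of the measure with weight [eps] on each vertex strictly above
    [S] and the rest of the mass on [S]. *)
Definition expectation_near (S : {set 'I_n}) (eps : R) (p : {mpoly R[n]}) : R :=
  (1 - eps * #|[pred A : {set 'I_n} | S \proper A]|%:R) * p.@[vertex R S]
    + eps * \sum_(A : {set 'I_n} | S \proper A) p.@[vertex R A].

Lemma expectation_near_sum_vars S eps :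
  \sum_(i < n) expectation_near S eps 'X_i =
    #|S|%:R + eps * \sum_(A : {set 'I_n} | S \proper A) (#|A|%:R - #|S|%:R).
Proof.
rewrite big_split /= -!mulr_sumr exchange_big /=.
have sumE A : \sum_(i < n) ('X_i : {mpoly R[n]}).@[vertex R A] = #|A|%:R.
  by rewrite -meval_vertex_sum raddf_sum.
rewrite sumE; under eq_bigr do rewrite sumE.
rewrite sumrB sumr_const -mulr_natl; ring.
Qed.

Lemma card_above_le S : (#|[pred A : {set 'I_n} | S \proper A]| <= 2 ^ n)%N.
Proof.
apply: leq_trans (max_card _) _.
by rewrite -cardsT -powersetT card_powerset cardsT card_ord.
Qed.

(** The last hypothesis balances the two sides of the constraint: its violation
    at [S] is [b - #|S|], amplified by the factor [2 ^+ n] of [sqr_bottom_le],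
    and each vertex above [S] pays with weight [eps] and slack at least
    [#|S| + 1 - b]. *)
Lemma expectation_near_feasible d S eps b :
  (#|S| + d < n)%N -> 0 <= eps -> eps * 2 ^+ n <= 1 ->
  #|S|%:R <= b -> (b - #|S|%:R) * 2 ^+ n <= eps * (#|S|%:R + 1 - b) ->
  lasserre_feasible d (F01_constraints n b) (expectation_near S eps).
Proof.
move=> ltSd eps_ge0 eps_le leSb le_b.
set N : R := #|[pred A : {set 'I_n} | S \proper A]|%:R.
have leN : N <= 2 ^+ n by rewrite -natrX ler_nat card_above_le.
have N_ge0 : 0 <= N by exact: ler0n.
have epsN : eps * N <= 1 by apply: le_trans eps_le; exact: ler_wpM2l.
split.
- move=> a p q _ _; rewrite /expectation_near mevalD mevalZ.
  under eq_bigr do rewrite mevalD mevalZ.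
  rewrite big_split /= -mulr_sumr; ring.
- rewrite /expectation_near meval1; under eq_bigr do rewrite meval1.
  rewrite sumr_const -/N; ring.
- move=> q _; rewrite /expectation_near -/N.
  apply: addr_ge0; apply: mulr_ge0 => //; first by rewrite subr_ge0.
    by rewrite meval_mlin rmorphXn sqr_ge0.
  by apply: sumr_ge0 => A _; rewrite meval_mlin rmorphXn sqr_ge0.
move=> q g spanq; rewrite inE => /eqP->.
have evalE A : (mlin (q ^+ 2 * (\sum_(i < n) 'X_i - b%:MP))).@[vertex R A] =
    q.@[vertex R A] ^+ 2 * (#|A|%:R - b).
  by rewrite meval_mlin mevalM mevalB mevalC meval_vertex_sum rmorphXn.
rewrite /expectation_near -/N evalE; under eq_bigr do rewrite evalE.
set Q := \sum_(A : {set 'I_n} | S \proper A) q.@[vertex R A] ^+ 2.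
have Q_ge0 : 0 <= Q by apply: sumr_ge0 => A _; exact: sqr_ge0.
have leQ : q.@[vertex R S] ^+ 2 <= N * Q := sqr_bottom_le ltSd spanq.
have above : Q * (#|S|%:R + 1 - b) <=
    \sum_(A : {set 'I_n} | S \proper A) q.@[vertex R A] ^+ 2 * (#|A|%:R - b).
  rewrite mulr_suml; apply: ler_sum => A /proper_card ltSA.
  apply: ler_wpM2l; first exact: sqr_ge0.
  by rewrite lerD2r natr1 ler_nat.
have below : (1 - eps * N) * q.@[vertex R S] ^+ 2 * (b - #|S|%:R) <=
    eps * (Q * (#|S|%:R + 1 - b)).
  have le1 : (1 - eps * N) * q.@[vertex R S] ^+ 2 <= 2 ^+ n * Q.
    apply: le_trans (_ : 1 * (N * Q) <= _); last first.
      by rewrite mul1r ler_wpM2r.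
    apply: ler_pM => //; rewrite ?subr_ge0 ?sqr_ge0 //.
    by rewrite gerBl mulr_ge0.
  apply: le_trans (ler_wpM2r _ le1) _; first by rewrite subr_ge0.
  have := ler_wpM2r Q_ge0 le_b; lra.
have := ler_wpM2l eps_ge0 above; lra.
Qed.

End Vertices.

Theorem theorem3p1 (R : realType) (n : nat) (hn : (1 <= n)%N) :
  exists P0 : R, 1 < P0 /\
    forall (P : rat) (L : nat),
      P0 <= ratr P -> (L < uphalf n)%N ->
      let b : R := L%:R + 1 / ratr P in
      forall d : nat,
        (forall y : {mpoly R[n]} -> R,
            lasserre_feasible d (F01_constraints n b) y ->
            (Num.ceil b)%:~R <= \sum_(i < n) y 'X_i) ->
        (n - L <= d)%N.
Proof.
(* The factor [n + 1] in [1 / eps] keeps the excess [eps * 2 ^ n * n] of the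
   expectation over [L] below 1. *)
set M : R := n.+1%:R * 2 ^+ n.
have pow_gt0 : 0 < 2 ^+ n :> R by rewrite exprn_gt0.
have M_gt0 : 0 < M by rewrite mulr_gt0 // ltr0n.
exists (1 + 2 ^+ n * M); split; first by rewrite ltrDl mulr_gt0.
move=> P L; set u : R := ratr P => leP ltL b d minimal.
have u_gt1 : 1 < u by apply: lt_le_trans leP; rewrite ltrDl mulr_gt0.
have u_gt0 : 0 < u by exact: lt_trans u_gt1.
rewrite leqNgt; apply/negP => ltd.
have [S cardS] : exists S : {set 'I_n}, #|S| = L.
  have leLn : (L <= n)%N by rewrite ltnW // -subn_gt0; exact: leq_ltn_trans ltd.
  exists [set widen_ord leLn i | i : 'I_L].
  by rewrite card_imset ?card_ord // => i j /(congr1 val) /= /val_inj.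
pose eps := M^-1; have eps_gt0 : 0 < eps by rewrite invr_gt0.
have epsE : eps * 2 ^+ n = n.+1%:R^-1.
  by rewrite /eps /M invfM -mulrA mulVf ?mulr1 // gt_eqF.
have feas : lasserre_feasible d (F01_constraints n b) (expectation_near S eps).
  apply: expectation_near_feasible; rewrite ?cardS //.
  - by rewrite -ltn_subRL.
  - exact: ltW.
  - by rewrite epsE invf_le1 ?ltr0n // ler1n.
  - by rewrite lerDl divr_ge0 // ltW.
  have -> : b - L%:R = u^-1 by rewrite /b -/u; ring.
  have -> : L%:R + 1 - b = (u - 1) * u^-1.
    by rewrite /b -/u; field; rewrite gt_eqF.
  rewrite mulrC mulrA ler_pM2r ?invr_gt0 // ler_pdivlMl // mulrC.
  by rewrite lerBrDl.
have := minimal _ feas; apply/negP; rewrite -ltNge.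
have ceil_b : L.+1%:R <= (Num.ceil b)%:~R :> R.
  have : (Posz L)%:~R < (Num.ceil b)%:~R :> R.
    by apply: lt_le_trans (ceil_ge b); rewrite ltrDl divr_gt0.
  by rewrite ltr_int -lezD1 -(ler_int R) intrD -natr1.
apply: lt_le_trans ceil_b.
rewrite expectation_near_sum_vars cardS -natr1 ltrD2l.
have : \sum_(A : {set 'I_n} | S \proper A) (#|A|%:R - L%:R) <= 2 ^+ n * n%:R :> R.
  apply: le_trans (_ : \sum_(A : {set 'I_n} | S \proper A) n%:R <= _).
    apply: ler_sum => A _; rewrite lerBlDr -natrD ler_nat.
    by apply: leq_trans (leq_addr _ _); rewrite -[leqRHS]card_ord max_card.
  rewrite sumr_const -[leLHS]mulr_natl ler_wpM2r ?ler0n // -natrX ler_nat.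
  exact: card_above_le.
move=> /(ler_wpM2l (ltW eps_gt0)) /le_lt_trans; apply.
by rewrite mulrA epsE mulrC ltr_pdivrMr ?ltr0n // mul1r ltr_nat.
Qed.
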